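(* Suppose that $f: X\times\Theta\to\mathbb{R}$ is continuous on $X\times\Theta$, and that $C:\Theta\rightrightarrows X$ is a continuous, compact-valued correspondence with $C(\theta)\neq\emptyset$ for all $\theta\in\Theta$. Let $T=\{(\theta_i,x^\ast(\theta_i)) : \theta_i\in\Theta,\ i=1,\dots,m\}$ be a training data set, where $x^\ast(\theta_i)$ is an arbitrarily chosen point of $C^\ast(\theta_i)$, and let $\mathcal{S}=\{S_1,\dots,S_d\}$ be a triangulation of $\{\theta_1,\dots,\theta_m\}$. For $\theta\in\mathrm{Conv}(\{\theta_1,\dots,\theta_m\})$, let $j_\theta$ be an index with $\theta\in\mathrm{Conv}(S_{j_\theta})$ and define $d(S_{j_\theta})=\max\{\|p-q\| : p,q\in\mathrm{Conv}(S_{j_\theta})\}$. Then the piecewise linear policy approximation $\hat{x}(\theta)$ satisfies the following. (a) If $\mathrm{Conv}(C^\ast(\theta))\subseteq C(\theta)$, then for given $\varepsilon>0$ there exists $\delta>0$ such that if $d(S_{j_\theta})<\delta$, then $\hat{x}(\theta)$ is an $\varepsilon$-infeasible solution. (b) If $f(x,\theta)=f^\ast(\theta)$ for all $x\in\mathrm{Conv}(C^\ast(\theta))$, then for given $\varepsilon>0$ there exists $\delta>0$ such that if $d(S_{j_\theta})<\delta$, then $\hat{x}(\theta)$ is an $\varepsilon$-suboptimal solution.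
   Context: Parametric optimization problem: $\min_x f(x,\theta)$ subject to $x\in C(\theta)$, where $x\in X\subset\mathbb{R}^n$ is the decision variable, $\theta\in\Theta\subset\mathbb{R}^k$ is the parameter, $f:\mathbb{R}^n\times\mathbb{R}^k\to\mathbb{R}$ is the objective function, and $C$ is a correspondence (set-valued map) from $\mathbb{R}^k$ to subsets of $\mathbb{R}^n$. Define $f^\ast(\theta)=\min_{x\in C(\theta)}f(x,\theta)$ and $C^\ast(\theta)=\{x\in C(\theta): f(x,\theta)=f^\ast(\theta)\}$; $x^\ast(\theta)$ denotes an element of $C^\ast(\theta)$. $\|\cdot\|$ is the Euclidean norm and $\mathrm{Conv}$ the convex hull. For a non-empty set $A$ of vectors and $\varepsilon>0$, $\mathcal{B}_\varepsilon(A)=\{y:\exists x\in A,\ \|x-y\|<\varepsilon\}$, and $\mathcal{B}_\delta(\theta_0)=\mathcal{B}_\delta(\{\theta_0\})$. A correspondence $C$ from the parameter space $\Theta$ is upper hemicontinuous at $\theta_0$ if for all $\varepsilon>0$ there is $\delta>0$ with $C(\theta)\subset\mathcal{B}_\varepsilon(C(\theta_0))$ for all $\theta\in\mathcal{B}_\delta(\theta_0)$; lower hemicontinuous at $\theta_0$ if for all $\varepsilon>0$ there is $\delta>0$ with $C(\theta_0)\subset\mathcal{B}_\varepsilon(C(\theta))$ for all $\theta\in\mathcal{B}_\delta(\theta_0)$; continuous at $\theta_0$ if it is both; continuous if continuous at every point of $\Theta$. A triangulation of $\{\theta_1,\dots,\theta_m\}\subset\mathbb{R}^k$ is a finite collection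 $\mathcal{S}=\{S_1,\dots,S_d\}$ of subsets of $\{\theta_1,\dots,\theta_m\}$ such that: (i) for each $j$, $|S_j|=k+1$ and $\mathrm{Conv}(S_j)$ is a $k$-dimensional simplex; (ii) $\mathrm{Conv}(\{\theta_1,\dots,\theta_m\})=\bigcup_{j=1}^d\mathrm{Conv}(S_j)$; (iii) for every non-empty $J\subseteq\{1,\dots,d\}$, $\bigcap_{j\in J}\mathrm{Conv}(S_j)=\mathrm{Conv}(\bigcap_{j\in J}S_j)$. Write $S_j=\{\theta^j_1,\dots,\theta^j_{k+1}\}$. Piecewise linear policy approximation: for $\theta\in\mathrm{Conv}(\{\theta_1,\dots,\theta_m\})$ with $\theta=\sum_{l=1}^{k+1}\lambda^{j_\theta}_l\theta^{j_\theta}_l$, $\lambda^{j_\theta}_l\ge0$, $\sum_l\lambda^{j_\theta}_l=1$, set $\hat{x}(\theta)=\sum_{l=1}^{k+1}\lambda^{j_\theta}_l\,x^\ast(\theta^{j_\theta}_l)$. For $\varepsilon>0$, $\hat{x}(\theta)$ is an $\varepsilon$-infeasible solution if $\hat{x}(\theta)\in\mathcal{B}_\varepsilon(C(\theta))$, and an $\varepsilon$-suboptimal solution if $|f(\hat{x}(\theta),\theta)-f(x^\ast(\theta),\theta)|<\varepsilon$.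
   Formalization: The point θ is assumed to lie in Θ, and part (b) additionally assumes that Conv(C*(θ)) ⊆ X and that x̂(θ) ∈ X, since f is given only on X×Θ; without this (b) is undefined or false when X is not convex. *)

(* Defs.v *)
From HB Require Import structures.
From mathcomp Require Import all_boot all_order all_algebra finmap.
From mathcomp Require Import all_classical all_reals all_analysis.
Import Order.TTheory GRing.Theory Num.Theory.
Import numFieldNormedType.Exports.

Set Implicit Arguments.
Unset Strict Implicit.
Unset Printing Implicit Defensive.

Local Open Scope classical_set_scope.
Local Open Scope ring_scope.

(* The library norm `|x| on 'rV[R]_n is the sup norm, hence an explicit
   Euclidean norm; both induce the same topology. *)
Definition enorm (R : realType) (n : nat) (x : 'rV[R]_n) : R :=
  Num.sqrt (\sum_(i < n) x ord0 i ^+ 2).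

Definition eball (R : realType) (n : nat) (eps : R) (A : set 'rV[R]_n) :
    set 'rV[R]_n :=
  [set y | exists2 x, A x & enorm (x - y) < eps].

Definition convex_hull (R : realType) (n : nat) (A : set 'rV[R]_n) :
    set 'rV[R]_n :=
  smallest (fun B : set 'rV[R]_n => convex_set B) A.

(* The supremum is a maximum on the sets this is used for, which are hulls of
   finite non-empty sets, hence compact. *)
Definition diameter (R : realType) (n : nat) (A : set 'rV[R]_n) : R :=
  sup [set enorm (p - q) | p in A & q in A].

(* A correspondence on Theta is represented by a total function whose values
   outside Theta are irrelevant: neighbourhoods are relative to Theta. *)
Definition upper_hemicontinuous_at (R : realType) (n k : nat)
    (Theta : set 'rV[R]_k) (C : 'rV[R]_k -> set 'rV[R]_n) (t0 : 'rV[R]_k) :=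
  forall eps : R, 0 < eps -> exists2 delta : R, 0 < delta &
    forall t, Theta t -> eball delta [set t0] t -> C t `<=` eball eps (C t0).

Definition lower_hemicontinuous_at (R : realType) (n k : nat)
    (Theta : set 'rV[R]_k) (C : 'rV[R]_k -> set 'rV[R]_n) (t0 : 'rV[R]_k) :=
  forall eps : R, 0 < eps -> exists2 delta : R, 0 < delta &
    forall t, Theta t -> eball delta [set t0] t -> C t0 `<=` eball eps (C t).

Definition continuous_correspondence (R : realType) (n k : nat)
    (Theta : set 'rV[R]_k) (C : 'rV[R]_k -> set 'rV[R]_n) :=
  forall t0, Theta t0 ->
    upper_hemicontinuous_at Theta C t0 /\ lower_hemicontinuous_at Theta C t0.

(* The infimum is a minimum when C t is compact and non-empty and f is
   continuous; if it were not attained, Cstar would be empty. *)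
Definition fstar (R : realType) (n k : nat) (f : 'rV[R]_n -> 'rV[R]_k -> R)
    (C : 'rV[R]_k -> set 'rV[R]_n) (t : 'rV[R]_k) : R :=
  inf [set f x t | x in C t].

Definition Cstar (R : realType) (n k : nat) (f : 'rV[R]_n -> 'rV[R]_k -> R)
    (C : 'rV[R]_k -> set 'rV[R]_n) (t : 'rV[R]_k) : set 'rV[R]_n :=
  [set x | C t x /\ f x t = fstar f C t].

Definition affinely_independent (R : realType) (k : nat)
    (V : {fset 'rV[R]_k}) :=
  forall c : 'rV[R]_k -> R,
    \sum_(v <- V) c v = 0 -> \sum_(v <- V) c v *: v = 0 ->
    forall v, v \in V -> c v = 0.

Definition is_simplex (R : realType) (k : nat) (dim : nat)
    (A : set 'rV[R]_k) :=
  exists V : {fset 'rV[R]_k},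
    [/\ #|` V| = dim.+1, affinely_independent V & A = convex_hull [set` V]].

Definition is_triangulation (R : realType) (k : nat) (P : set 'rV[R]_k)
    (d : nat) (S : 'I_d -> {fset 'rV[R]_k}) :=
  [/\ forall j, [set` S j] `<=` P,
      forall j, #|` S j| = k.+1 /\ is_simplex k (convex_hull [set` S j]),
      convex_hull P = \bigcup_j convex_hull [set` S j] &
      forall J : set 'I_d, J !=set0 ->
        \bigcap_(j in J) convex_hull [set` S j] =
        convex_hull (\bigcap_(j in J) [set` S j])].

Definition barycentric_coordinates (R : realType) (k : nat)
    (V : {fset 'rV[R]_k}) (t : 'rV[R]_k) (lambda : 'rV[R]_k -> R) :=
  [/\ forall v, v \in V -> 0 <= lambda v,
      \sum_(v <- V) lambda v = 1 & t = \sum_(v <- V) lambda v *: v].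

(* The value at t of the piecewise linear policy approximation when V is the
   vertex set of a cell containing t and lambda the coordinates of t in V. *)
Definition pwl_policy (R : realType) (n k : nat)
    (xstar : 'rV[R]_k -> 'rV[R]_n) (V : {fset 'rV[R]_k})
    (lambda : 'rV[R]_k -> R) : 'rV[R]_n :=
  \sum_(v <- V) lambda v *: xstar v.

Definition eps_infeasible (R : realType) (n k : nat)
    (C : 'rV[R]_k -> set 'rV[R]_n) (eps : R) (t : 'rV[R]_k) (x : 'rV[R]_n) :=
  eball eps (C t) x.

Definition eps_suboptimal (R : realType) (n k : nat)
    (f : 'rV[R]_n -> 'rV[R]_k -> R) (xstar : 'rV[R]_k -> 'rV[R]_n) (eps : R)
    (t : 'rV[R]_k) (x : 'rV[R]_n) :=
  `|f x t - f (xstar t) t| < eps.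

(* Main.v *)
(* By Berge's maximum theorem C* is upper hemicontinuous at t. The vertices of a
   cell of small diameter containing t are close to t, so their chosen optima lie
   near C*(t), and the approximation lies near a convex combination of k + 1
   points of C*(t). This gives (a); such combinations form a compact set, on
   which f(., t) is constant in (b), and f is continuous uniformly around it. *)
Require Import Defs.
From HB Require Import structures.
From mathcomp Require Import all_boot all_order all_algebra finmap.
From mathcomp Require Import lra.
From mathcomp Require Import all_classical all_reals all_analysis.
Import Order.TTheory GRing.Theory Num.Theory.
Import numFieldNormedType.Exports.
Set Implicit Arguments.
Unset Strict Implicit.
Unset Printing Implicit Defensive.

Local Open Scope classical_set_scope.
Local Open Scope ring_scope.

(** * Comparison of the Euclidean norm with the sup norm *)

Lemma normr_le_enorm (R : realType) (n : nat) (x : 'rV[R]_n) : `|x| <= enorm x.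
Proof.
rewrite [leLHS]/Num.norm /= mx_normrE; apply/bigmax_leP; split => [|[i j] _ /=].
  exact: sqrtr_ge0.
rewrite ord1 -sqrtr_sqr ler_sqrt ?sumr_ge0 // => [|l _]; last exact: sqr_ge0.
by rewrite (bigD1 j) //= lerDl sumr_ge0 // => l _; exact: sqr_ge0.
Qed.

Lemma coord_le_normr (R : realType) (n : nat) (x : 'rV[R]_n) (i : 'I_n) :
  `|x ord0 i| <= `|x|.
Proof.
rewrite [leRHS]/Num.norm /= mx_normrE.
exact: (le_bigmax _ (fun ij : 'I_1 * 'I_n => `|x ij.1 ij.2|) (ord0, i)).
Qed.

(** The crude factor [n.+1] is positive even for [n = 0], so tolerances can be divided by it. *)
Lemma enorm_le_normr (R : realType) (n : nat) (x : 'rV[R]_n) :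
  enorm x <= n.+1%:R * `|x|.
Proof.
rewrite -[leRHS]ger0_norm ?mulr_ge0 // -sqrtr_sqr ler_sqrt ?sqr_ge0 //.
apply: (@le_trans _ _ (\sum_(i < n) `|x| ^+ 2)).
  apply: ler_sum => i _; rewrite -[leLHS]ger0_norm ?sqr_ge0 // normrX.
  by rewrite lerXn2r ?nnegrE // coord_le_normr.
rewrite sumr_const card_ord -[leLHS]mulr_natl exprMn ler_wpM2r ?sqr_ge0 //.
rewrite -natrX ler_nat expnS expn1 (leq_trans (leqnSn n)) // leq_pmull //.
Qed.

Lemma eball_normr_lt (R : realType) (n : nat) (e : R) (A : set 'rV[R]_n) x y :
  A x -> `|x - y| < e / n.+1%:R -> eball e A y.
Proof.
move=> Ax xy; exists x => //; apply: (le_lt_trans (enorm_le_normr _)).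
by rewrite mulrC -ltr_pdivlMr.
Qed.

(** Each point of [K] comes with its own radius; compactness, in its near-covering form, yields a
    common one. *)
Lemma compact_tube (R : realType) (V W : normedModType R) (K : set V) (t : W)
    (Q : V -> W -> Prop) :
  compact K ->
  (forall x, K x -> \forall y \near x & s \near t, Q y s) ->
  exists2 r : R, 0 < r &
    forall x y s, K x -> `|x - y| < r -> `|t - s| < r -> Q y s.
Proof.
move=> /compact_near_coveringP cK loc.
have : \forall r \near (0 : R)^'+,
    K `<=` (fun x => forall y s, `|x - y| < r -> `|t - s| < r -> Q y s).
  apply: cK => x Kx.
  have [[/= A B] [/nbhs_normP[a a0 aA] /nbhs_normP[b b0 bB]] ABQ] := loc x Kx.
  rewrite /= in a0 b0.
  (* With both radii halved, a point within [r] of some [x'] in the ball is still within [a] of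
     [x]. *)
  exists (ball x (a / 2), [set r : R | r < a / 2 /\ r < b]) => /=.
    split; first by apply: nbhsx_ballx; rewrite divr_gt0.
    by apply: filterI; apply: nbhs_right_lt; rewrite ?divr_gt0.
  move=> [x' r] /= [xx' [ra rb]] y s x'y ts.
  apply: (ABQ (y, s)); split => /=; last by apply: bB => /=; exact: lt_trans rb.
  apply: aA => /=; rewrite -(subrKA x') (le_lt_trans (ler_normD _ _)) //.
  rewrite [ltRHS]splitr ltrD //; last exact: lt_trans ra.
  by move: xx'; rewrite -ball_normE.
move=> h; have [r [r0 Kr]] : exists r : R, 0 < r /\
    K `<=` (fun x => forall y s, `|x - y| < r -> `|t - s| < r -> Q y s).
  by apply: (@filter_ex _ (0 : R)^'+); apply: filterI => //; exact: nbhs_right_gt.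
by exists r => // x y s /Kr; apply.
Qed.

(** * Convex combinations, hulls and their compactness *)

(* Weighted sums of [j] points, paired with their total weight: keeping
   the weight unconstrained makes this an iterated continuous image, hence
   compact, and the slice of weight 1 consists of convex combinations. *)
Fixpoint weighted_sums (R : realType) (n : nat) (A : set 'rV[R]_n) (j : nat) :
    set (R^o * 'rV[R]_n) :=
  if j is j'.+1 then
    (fun p : (R^o * 'rV[R]_n) * (R^o * 'rV[R]_n) =>
      (p.1.1 + p.2.1, p.1.1 *: p.1.2 + p.2.2)) @`
    ((`[0, 1] `*` A) `*` @weighted_sums R n A j')
  else [set 0].

Lemma weighted_sums_compact (R : realType) (n : nat) (A : set 'rV[R]_n) j :
  compact A -> compact (weighted_sums A j).
Proof.
move=> cA; elim: j => [|j IH] /=; first exact: compact_set1.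
apply: continuous_compact; last first.
  by do 2?apply: compact_setX => //; exact: segment_compact.
apply: continuous_subspaceT => p.
have c11 : (q.1.1 @[q --> p]) --> p.1.1.
  exact: (cvg_comp _ _ (@cvg_fst _ _ _ _ _) (@cvg_fst _ _ _ _ _)).
have c12 : (q.1.2 @[q --> p]) --> p.1.2.
  exact: (cvg_comp _ _ (@cvg_fst _ _ _ _ _) (@cvg_snd _ _ _ _ _)).
have c21 : (q.2.1 @[q --> p]) --> p.2.1.
  exact: (cvg_comp _ _ (@cvg_snd _ _ _ _ _) (@cvg_fst _ _ _ _ _)).
have c22 : (q.2.2 @[q --> p]) --> p.2.2.
  exact: (cvg_comp _ _ (@cvg_snd _ _ _ _ _) (@cvg_snd _ _ _ _ _)).
apply: (@cvg_pair _ _ _ (nbhs p) (nbhs (p.1.1 + p.2.1))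
    (nbhs (p.1.1 *: p.1.2 + p.2.2))).
  exact: cvgD.
by apply: cvgD c22; exact: cvgZ.
Qed.

Lemma weighted_sums_seq (R : realType) (n : nat) (A : set 'rV[R]_n)
    (T : eqType) (s : seq T) (c : T -> R) (y : T -> 'rV[R]_n) :
  (forall v, v \in s -> 0 <= c v <= 1) -> (forall v, v \in s -> A (y v)) ->
  weighted_sums A (size s) (\sum_(v <- s) c v : R^o, \sum_(v <- s) c v *: y v).
Proof.
elim: s => [|v s IH] hc hy /=; first by rewrite !big_nil.
rewrite !big_cons.
exists ((c v, y v), (\sum_(v <- s) c v, \sum_(v <- s) c v *: y v)) => //=.
split; last by apply: IH => u us; [apply: hc|apply: hy]; rewrite inE us orbT.
split; last by apply: hy; rewrite mem_head.
by rewrite /= in_itv /=; apply: hc; rewrite mem_head.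
Qed.

Lemma convex_hull_sub (R : realType) (n : nat) (A : set 'rV[R]_n) :
  A `<=` convex_hull A.
Proof. exact: sub_smallest. Qed.

Lemma convex_hull_convex (R : realType) (n : nat) (A : set 'rV[R]_n)
    (a b : R) x y :
  0 <= a -> 0 <= b -> a + b = 1 -> convex_hull A x -> convex_hull A y ->
  convex_hull A (a *: x + b *: y).
Proof.
move=> a0 b0 ab hx hy B [cB AB].
have a1 : a <= 1 by rewrite -ab lerDl.
have := cB x y (Itv01 a0 a1); rewrite !inE => /(_ _ _)/=.
have -> : b = 1 - a by rewrite -ab addrAC subrr add0r.
by apply; [exact: hx|exact: hy].
Qed.

(** Dividing by the total weight gives the hull point. A total of zero forces all the nonnegative
    coefficients to vanish, hence the first alternative. *)
Lemma weighted_sums_hull (R : realType) (n : nat) (A : set 'rV[R]_n) j p :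
  weighted_sums A j p ->
  p = 0 \/ 0 < p.1 /\ exists2 h, convex_hull A h & p.2 = p.1 *: h.
Proof.
elim: j p => [|j IH] p /=; first by left.
move=> [[[a x] [w z]] [/= [+ Ax] wz] <-] /=; rewrite in_itv /= => /andP[a0 _].
have hx := @convex_hull_sub _ _ A x Ax.
have [->|an0] := eqVneq a 0.
  by rewrite !add0r scale0r add0r; exact: IH.
have {an0}a0 : 0 < a by rewrite lt_neqAle eq_sym an0.
case: (IH _ wz) => [[-> ->]|[/= w0 [h hh ->]]]; right.
  by rewrite !addr0; split => //; exists x.
have aw : 0 < a + w by rewrite addr_gt0.
(* The new hull point averages [x] and [h] in proportion to their weights [a] and [w]. *)
split => //; exists ((a / (a + w)) *: x + (w / (a + w)) *: h).
  apply: convex_hull_convex => //; rewrite ?divr_ge0 // ?ltW //.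
  by rewrite -mulrDl divff ?gt_eqF.
by rewrite scalerDr !scalerA ![(a + w) * _]mulrC !divfK ?gt_eqF.
Qed.

Lemma weighted_sums_slice_hull (R : realType) (n : nat) (A : set 'rV[R]_n) j z :
  weighted_sums A j (1 : R^o, z) -> convex_hull A z.
Proof.
move=> /weighted_sums_hull[[/eqP]|[_ [h hh /= ->]]]; last by rewrite scale1r.
by rewrite oner_eq0.
Qed.

(** The closed ball of radius [M] is convex, so it contains the smallest convex set around [A]. *)
Lemma convex_hull_bounded (R : realType) (n : nat) (A : set 'rV[R]_n) (M : R) :
  (forall x, A x -> `|x| <= M) -> forall x, convex_hull A x -> `|x| <= M.
Proof.
move=> AM; apply: smallest_sub => //= x y l; rewrite !inE /= => xM yM.
change (`|l%:num *: (x : 'rV[R]_n) + (1 - l%:num) *: (y : 'rV[R]_n)| <= M).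
have l1 : 0 <= 1 - l%:num by rewrite subr_ge0.
rewrite (le_trans (ler_normD _ _)) // !normrZ !ger0_norm //.
rewrite -[leRHS]mul1r -[X in X * M](subrKC l%:num) [leRHS]mulrDl.
by rewrite lerD // ler_wpM2l.
Qed.

Lemma le_diameter_convex_hull (R : realType) (k : nat) (V : {fset 'rV[R]_k}) p q :
  convex_hull [set` V] p -> convex_hull [set` V] q ->
  enorm (p - q) <= diameter (convex_hull [set` V]).
Proof.
move=> hp hq; apply: ub_le_sup; last by exists p => //; exists q.
(* A supremum dominates its set only when that set is bounded above: the sum of the vertex norms
   bounds each vertex, hence the hull. *)
have hM := @convex_hull_bounded _ _ [set` V] (\sum_(v <- V) `|v|).
exists (k.+1%:R * (2 * \sum_(v <- V) `|v|)) => _ [x hx [y hy <-]].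
apply: (le_trans (enorm_le_normr _)).
rewrite ler_wpM2l // (le_trans (ler_normB _ _)) // mulr_natl mulr2n.
rewrite lerD // hM // => v /= vV; rewrite (big_fsetD1 v) //= lerDl sumr_ge0 //.
Qed.

(** The slice is the projection of the compact set of weighted sums cut by the closed condition that
    the weight is 1. *)
Lemma weighted_sums_slice_compact (R : realType) (n : nat) (A : set 'rV[R]_n) j :
  compact A -> compact [set z | weighted_sums A j (1 : R^o, z)].
Proof.
move=> cA; pose F := (fst : R^o * 'rV[R]_n -> R^o) @^-1` [set 1].
have -> : [set z | weighted_sums A j (1 : R^o, z)] =
    snd @` (weighted_sums A j `&` F).
  apply/seteqP; split => [z wz|_ [[w z] [wz /= w1] <-]]; first by exists (1, z).
  by rewrite /F /= in w1; rewrite -w1.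
apply: continuous_compact.
  by apply: continuous_subspaceT => p; exact: cvg_snd.
apply: compact_closedI; first exact: weighted_sums_compact.
by apply: closed_comp => [p _|]; [exact: cvg_fst|exact: closed_eq].
Qed.

(** Applying the same weights to points of [A] near the [xstar v] makes the error a weighted mean of
    errors below [e]. *)
Lemma pwl_policy_near (R : realType) (n k : nat) (A : set 'rV[R]_n)
    (xstar : 'rV[R]_k -> 'rV[R]_n) (V : {fset 'rV[R]_k}) (t : 'rV[R]_k)
    (lambda : 'rV[R]_k -> R) (e : R) :
  barycentric_coordinates V t lambda ->
  (forall v, v \in V -> exists2 x, A x & `|x - xstar v| < e) ->
  exists2 z, weighted_sums A #|` V| (1 : R^o, z) &
    `|z - pwl_policy xstar V lambda| <= e.
Proof.
move=> [l0 l1 _] hV.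
have /choice[y hy] v : exists x, v \in V -> A x /\ `|x - xstar v| < e.
  have [/hV[x Ax xe]|vV] := boolP (v \in V); first by exists x.
  by exists 0.
exists (\sum_(v <- V) lambda v *: y v).
  rewrite -l1; apply: weighted_sums_seq => v vV; last by have [] := hy v vV.
  (* Each weight is at most the total 1 because the others are nonnegative. *)
  rewrite l0 //= -l1 (big_fsetD1 v) //= lerDl big_seq sumr_ge0 // => u.
  by rewrite !inE => /andP[_]; exact: l0.
rewrite /pwl_policy -sumrB (le_trans (ler_norm_sum _ _ _)) //.
rewrite -[leRHS]mul1r -l1 mulr_suml !big_seq ler_sum // => v vV.
rewrite -scalerBr normrZ ger0_norm ?l0 // ler_wpM2l ?l0 //.
by rewrite ltW //; have [] := hy v vV.
Qed.

(** * Hemicontinuity expressed in the sup norm *)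

Lemma upper_hemicontinuous_atP (R : realType) (n k : nat) (Theta : set 'rV[R]_k)
    (C : 'rV[R]_k -> set 'rV[R]_n) t (e : R) :
  upper_hemicontinuous_at Theta C t -> 0 < e ->
  exists2 r : R, 0 < r & forall s y, Theta s -> `|t - s| < r -> C s y ->
    exists2 x, C t x & `|x - y| < e.
Proof.
move=> /[apply] -[r r0 h]; exists (r / k.+1%:R); first by rewrite divr_gt0.
move=> s y Ts ts Csy.
have [|x Ctx xy] := h s Ts _ y Csy; first exact: (eball_normr_lt (x := t)).
by exists x => //; exact: le_lt_trans (normr_le_enorm _) xy.
Qed.

Lemma lower_hemicontinuous_atP (R : realType) (n k : nat) (Theta : set 'rV[R]_k)
    (C : 'rV[R]_k -> set 'rV[R]_n) t (e : R) :
  lower_hemicontinuous_at Theta C t -> 0 < e ->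
  exists2 r : R, 0 < r & forall s x, Theta s -> `|t - s| < r -> C t x ->
    exists2 y, C s y & `|y - x| < e.
Proof.
move=> /[apply] -[r r0 h]; exists (r / k.+1%:R); first by rewrite divr_gt0.
move=> s x Ts ts Ctx.
have [|y Csy yx] := h s Ts _ x Ctx; first exact: (eball_normr_lt (x := t)).
by exists y => //; exact: le_lt_trans (normr_le_enorm _) yx.
Qed.

(** * Berge's maximum theorem and its effect on the approximation *)

Section Berge.
Context (R : realType) (n k : nat) (X : set 'rV[R]_n) (Theta : set 'rV[R]_k).
Context (f : 'rV[R]_n -> 'rV[R]_k -> R) (C : 'rV[R]_k -> set 'rV[R]_n).
Hypothesis f_continuous : {within X `*` Theta,
  continuous (fun p : 'rV[R]_n * 'rV[R]_k => f p.1 p.2)}.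
Hypothesis C_sub : forall t, Theta t -> C t `<=` X.
Hypothesis C_continuous : continuous_correspondence Theta C.
Hypothesis C_compact : forall t, Theta t -> compact (C t).

Lemma within_continuous_near x t (e : R) : X x -> Theta t -> 0 < e ->
  \forall y \near x & s \near t, X y -> Theta s -> `|f x t - f y s| < e.
Proof.
move=> Xx Tt e0.
have /subspace_continuousP/(_ (x, t) (conj Xx Tt))/cvgrPdist_lt/(_ e e0) :=
  f_continuous.
rewrite /prop_near1 /within /= => h.
by apply: (@filterS _ (nbhs (x, t))) h => -[y s] /= h Xy Ts; exact: h.
Qed.

Lemma within_continuous_section t : Theta t -> {within C t, continuous f^~ t}.
Proof.
move=> Tt; apply/subspace_continuousP => x Cx; apply/cvgrPdist_lt => e e0.
have [[/= A B] [Ax /nbhs_singleton Bt] AB] :=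
  within_continuous_near (C_sub Tt Cx) Tt e0.
apply: (@filterS _ (nbhs x)) Ax => y Ay Cy.
by apply: (AB (y, t)) => //; exact: C_sub Cy.
Qed.

(** An infimum is a lower bound only of a set bounded below, which the extreme value theorem on
    [C t] provides. *)
Lemma fstar_le t x : Theta t -> C t x -> fstar f C t <= f x t.
Proof.
move=> Tt Cx.
have C0 : C t !=set0 by exists x.
have [c _ hc] := compact_EVT_min C0 (C_compact Tt)
  (within_continuous_section Tt).
apply: ge_inf; last by exists x.
by exists (f c t) => _ [y Cy <-]; apply: hc; rewrite inE.
Qed.

Lemma Cstar_min t x : Theta t -> C t x -> (forall y, C t y -> f x t <= f y t) ->
  Cstar f C t x.
Proof.
move=> Tt Cx xmin; split => //; apply/eqP; rewrite eq_le fstar_le // andbT.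
by apply: lb_le_inf => [|_ [y Cy <-]]; [exists (f x t), x|exact: xmin].
Qed.

Lemma Cstar_compact t : Theta t -> compact (Cstar f C t).
Proof.
move=> Tt; have /continuous_closedP := within_continuous_section Tt.
move=> /(_ [set fstar f C t] (@closed_eq _ _)).
move=> /closed_subspaceP[V cV VE].
have -> : Cstar f C t = C t `&` V.
  by rewrite setIC VE setIC.
exact: compact_closedI (C_compact Tt) cV.
Qed.

(** [Q] holds near every [x] in [C t]. If [x] is optimal, it is itself the witness. Otherwise some
    [x0] is strictly better, lower hemicontinuity gives points of [C s] near [x0], and these beat
    every [y] near [x], so no such [y] is optimal for [s]. *)
Lemma Cstar_upper_hemicontinuous t (e : R) : Theta t -> 0 < e ->
  exists2 r : R, 0 < r & forall s y, Theta s -> `|t - s| < r ->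
    Cstar f C s y -> exists2 x, Cstar f C t x & `|x - y| < e.
Proof.
move=> Tt e0.
pose Q y s := Theta s -> Cstar f C s y -> exists2 x, Cstar f C t x & `|x - y| < e.
have [uC lC] := C_continuous Tt.
have [|r r0 hr] := @compact_tube _ _ _ _ t Q (C_compact Tt).
  move=> x Cx; have [Sx|nSx] := pselect (Cstar f C t x).
    exists (ball x e, setT) => /=; first by split; [exact: nbhsx_ballx|exact: filterT].
    by move=> [y s] [/= + _] _ _; rewrite -ball_normE => xy; exists x.
  have [x0 Cx0 fx0] : exists2 x0, C t x0 & f x0 t < f x t.
    apply: contrapT => h; apply: nSx; apply: Cstar_min => // y Cy.
    by rewrite leNgt; apply/negP => fy; apply: h; exists y.
  (* Half the gap: [f y s] stays above the midpoint of the two values and [f z s] below it. *)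
  have g0 : 0 < (f x t - f x0 t) / 2 by rewrite divr_gt0 // subr_gt0.
  have [[/= A B] [Ax Bt] AB] := within_continuous_near (C_sub Tt Cx) Tt g0.
  have [[/= A0 B0] [/nbhs_normP[a a0 aA0] B0t] AB0] :=
    within_continuous_near (C_sub Tt Cx0) Tt g0.
  have [d d0 hd] := lower_hemicontinuous_atP lC a0.
  exists (A, B `&` B0 `&` ball t d) => /=.
    by split => //; apply: filterI; [exact: filterI|exact: nbhsx_ballx].
  move=> [y s] [/= Ay [[Bs B0s]]]; rewrite -ball_normE /= => ts Ts [Cy fy].
  have [z Cz zx0] := hd s x0 Ts ts Cx0.
  have := AB (y, s) (conj Ay Bs) (C_sub Ts Cy) Ts.
  have A0z : A0 z by apply: aA0; rewrite /= distrC.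
  have := AB0 (z, s) (conj A0z B0s) (C_sub Ts Cz) Ts.
  have := fstar_le Ts Cz; rewrite -fy /= !ltr_norml.
  by move=> h /andP[h1 h2] /andP[h3 h4]; exfalso; lra.
(* Upper hemicontinuity of [C] brings every feasible [y] into the tube of radius [r] around
   [C t]. *)
have [d d0 hd] := upper_hemicontinuous_atP uC r0.
exists (Num.min r d); first by rewrite lt_min r0.
move=> s y Ts; rewrite lt_min => /andP[tsr tsd] Sy.
have [x Cx xy] := hd s y Ts tsd Sy.1.
exact: hr x y s Cx xy tsr Ts Sy.
Qed.

(** Both [t] and the vertices lie in the hull of [V], so the diameter bounds their distances. The
    nearby point is kept as a weighted sum because (b) needs it in a compact set. *)
Lemma Cstar_pwl_policy_near t (e : R) : Theta t -> 0 < e ->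
  exists2 r : R, 0 < r &
  forall (xstar : 'rV[R]_k -> 'rV[R]_n) (V : {fset 'rV[R]_k})
    (lambda : 'rV[R]_k -> R),
  (forall s, Theta s -> Cstar f C s (xstar s)) -> [set` V] `<=` Theta ->
  convex_hull [set` V] t -> barycentric_coordinates V t lambda ->
  diameter (convex_hull [set` V]) < r ->
  exists2 z, weighted_sums (Cstar f C t) #|` V| (1 : R^o, z) &
    `|z - pwl_policy xstar V lambda| < e.
Proof.
(* Halving [e] turns the non-strict bound of [pwl_policy_near] into a strict one. *)
move=> Tt e0; have e2 : 0 < e / 2 by rewrite divr_gt0.
have [r r0 hr] := Cstar_upper_hemicontinuous Tt e2.
exists r => // xstar V lambda xS VT tV bc dV.
have [v vV|z wz ze] :=
  pwl_policy_near (A := Cstar f C t) (e := e / 2) (xstar := xstar) bc.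
  apply: (hr v); [exact: VT| |by apply: xS; exact: VT].
  apply: le_lt_trans dV; apply: le_trans (normr_le_enorm _) _.
  by apply: le_diameter_convex_hull => //; exact: convex_hull_sub.
exists z => //; apply: le_lt_trans ze _.
by rewrite ltr_pdivrMr // ltr_pMr // ltr1n.
Qed.

End Berge.

(** * Infeasibility and suboptimality bounds *)

Unset Implicit Arguments.

(* f is only meaningful on X x Theta: in (b) the assumptions that the hull of
   the optimal set lies in X and that the approximation takes its value in X
   say that the expressions f(x, t) and f(xhat(t), t) are defined; both hold
   when X is convex. The threshold delta depends on t and eps only, not on the
   training data or the triangulation whose cell diameter it bounds. *)
Theorem theorem3p2 (R : realType) (n k : nat)
    (X : set 'rV[R]_n) (Theta : set 'rV[R]_k)
    (f : 'rV[R]_n -> 'rV[R]_k -> R) (C : 'rV[R]_k -> set 'rV[R]_n)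
    (f_continuous : {within X `*` Theta,
       continuous (fun p : 'rV[R]_n * 'rV[R]_k => f p.1 p.2)})
    (C_sub : forall t, Theta t -> C t `<=` X)
    (C_continuous : continuous_correspondence Theta C)
    (C_compact : forall t, Theta t -> compact (C t))
    (C_nonempty : forall t, Theta t -> C t !=set0)
    (t : 'rV[R]_k) (Theta_t : Theta t) :
  (* (a) *)
  (convex_hull (Cstar f C t) `<=` C t ->
   forall eps : R, 0 < eps ->
   exists2 delta : R, 0 < delta &
   forall (xstar : 'rV[R]_k -> 'rV[R]_n) (m : nat) (theta : 'I_m -> 'rV[R]_k)
     (d : nat) (S : 'I_d -> {fset 'rV[R]_k}) (j : 'I_d)
     (lambda : 'rV[R]_k -> R),
     (forall s, Theta s -> Cstar f C s (xstar s)) ->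
     (forall i, Theta (theta i)) ->
     is_triangulation (range theta) S ->
     convex_hull (range theta) t ->
     convex_hull [set` S j] t ->
     barycentric_coordinates (S j) t lambda ->
     diameter (convex_hull [set` S j]) < delta ->
     eps_infeasible C eps t (pwl_policy xstar (S j) lambda))
  /\
  (* (b) *)
  (convex_hull (Cstar f C t) `<=` X ->
   (forall x, convex_hull (Cstar f C t) x -> f x t = fstar f C t) ->
   forall eps : R, 0 < eps ->
   exists2 delta : R, 0 < delta &
   forall (xstar : 'rV[R]_k -> 'rV[R]_n) (m : nat) (theta : 'I_m -> 'rV[R]_k)
     (d : nat) (S : 'I_d -> {fset 'rV[R]_k}) (j : 'I_d)
     (lambda : 'rV[R]_k -> R),
     (forall s, Theta s -> Cstar f C s (xstar s)) ->
     (forall i, Theta (theta i)) ->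
     is_triangulation (range theta) S ->
     convex_hull (range theta) t ->
     convex_hull [set` S j] t ->
     barycentric_coordinates (S j) t lambda ->
     diameter (convex_hull [set` S j]) < delta ->
     X (pwl_policy xstar (S j) lambda) ->
     eps_suboptimal f xstar eps t (pwl_policy xstar (S j) lambda)).

Proof.
have Svert m (theta : 'I_m -> 'rV[R]_k) d (S : 'I_d -> {fset 'rV[R]_k}) j :
    (forall i, Theta (theta i)) -> is_triangulation (range theta) S ->
    [set` S j] `<=` Theta /\ #|` S j| = k.+1.
  move=> thT [SP Sk _ _]; split; last by have [] := Sk j.
  by move=> v /SP[i _ <-].
have near_hull := Cstar_pwl_policy_near f_continuous C_sub C_continuous
  C_compact Theta_t.
split=> [hullC eps eps0|hullX fhull eps eps0].
  have [|delta d0 hd] := near_hull (eps / n.+1%:R); first by rewrite divr_gt0.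
  exists delta => // xstar m theta d S j lambda xS thT tri _ tS bc dS.
  have [ST _] := Svert _ _ _ _ j thT tri.
  have [z wz ze] := hd _ _ _ xS ST tS bc dS.
  by apply: (eball_normr_lt (x := z)) => //; apply: hullC;
    exact: weighted_sums_slice_hull wz.
(* Every cell has [k.+1] vertices, so this compact set is the same for all triangulations. *)
have cK := weighted_sums_slice_compact (j := k.+1)
  (Cstar_compact f_continuous C_sub C_compact Theta_t).
have [|r r0 hr] := compact_tube (t := t)
    (Q := fun y s => X y -> Theta s -> `|fstar f C t - f y s| < eps) cK.
  move=> x /weighted_sums_slice_hull hx; rewrite -(fhull x hx).
  exact: (within_continuous_near f_continuous (hullX x hx) Theta_t eps0).
have [delta d0 hd] := near_hull r r0.
exists delta => // xstar m theta d S j lambda xS thT tri _ tS bc dS Xx.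
have [ST Sk] := Svert _ _ _ _ j thT tri.
have [z + zr] := hd _ _ _ xS ST tS bc dS; rewrite Sk => wz.
have [_ fxs] := xS t Theta_t.
rewrite /eps_suboptimal fxs distrC.
(* The tube is used at the fixed parameter [t]: only the decision variable moves. *)
by apply: (hr z _ t wz zr) => //; rewrite subrr normr0.
Qed.
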